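(* Let $\omega=d\hat u^2+\hat G(\hat u,\hat v)\,d\hat v^2$ be a metric with $\hat G>0$ of class $C^1$. Let $u=h(\hat u+\hat v)$, where $h$ is a $C^1$ function of one variable with nowhere vanishing derivative (so that $u$ solves $u_{\hat u}-u_{\hat v}=0$ with initial condition $u=h(\hat u)$ on $\hat v=0$), and let $v=\hat h(\hat u,\hat v)$ be a $C^1$ solution of $$\hat G(\hat u,\hat v)\,v_{\hat u}+v_{\hat v}=0$$ whose initial values $\hat h(\hat u,0)$ on $\hat v=0$ satisfy $\hat h_{\hat u}(\hat u,0)\neq 0$. The parameter transformation $(\hat u,\hat v)\mapsto(u,v)$ is locally invertible near the initial curve $\hat v=0$; write its local $C^1$ inverse as $\hat u=f(u,v)$, $\hat v=g(u,v)$. Define $$R(u,v)=[u_{\hat v}]^{-2}\,\frac{\hat G(f(u,v),g(u,v))}{\hat G(f(u,v),g(u,v))+1},$$ $$S(u,v)=\bigl[\hat h_{\hat v}(f(u,v),g(u,v))\bigr]^{-2}\,\frac{[\hat G(f(u,v),g(u,v))]^2}{\hat G(f(u,v),g(u,v))+1},$$ where $u_{\hat v}=h'(\hat u+\hat v)$ is evaluated at $\hat u=f(u,v)$, $\hat v=g(u,v)$. Then $R(u,v)$ and $S(u,v)$ are components of $\omega$ in the parameters $u,v$, that is, $$\omega=R(u,v)\,du^2+S(u,v)\,dv^2 .$$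
   Context: Subscripts denote partial derivatives, a prime denotes the derivative of a function of one variable. All assertions are local, in a neighborhood of (a point of) the initial curve $\hat v=0$. That $R,0,S$ are the components of $\omega$ in the parameters $u,v$ means equivalently that $1=Ru_{\hat u}^2+Sv_{\hat u}^2$, $0=Ru_{\hat u}u_{\hat v}+Sv_{\hat u}v_{\hat v}$, $\hat G=Ru_{\hat v}^2+Sv_{\hat v}^2$. *)

(* Defs.v *)
From Stdlib Require Import Reals.
From Coquelicot Require Import Coquelicot.
Open Scope R_scope.

Definition pd1 (F : R -> R -> R) (x y : R) : R := Derive (fun z => F z y) x.
Definition pd2 (F : R -> R -> R) (x y : R) : R := Derive (fun z => F x z) y.

Definition C1_on (J : R -> Prop) (h : R -> R) : Prop :=
  forall t, J t -> ex_derive h t /\ continuous (Derive h) t.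

(* [ex_diff_n F 1] at a point: [F] and both first partial derivatives exist and
   are (jointly) continuous there. *)
Definition C1_on2 (D : R * R -> Prop) (F : R -> R -> R) : Prop :=
  forall x y, D (x, y) -> ex_diff_n F 1 x y.

(* Functions are total, so [f] and [g] are meaningful only on [V]. *)
Record local_C1_inverse (D : R * R -> Prop) (p : R * R) (u v : R -> R -> R)
    (U V : R * R -> Prop) (f g : R -> R -> R) : Prop := {
  lci_openU : open U;
  lci_openV : open V;
  lci_point : U p;
  lci_sub : forall q, U q -> D q;
  lci_to : forall x y, U (x, y) -> V (u x y, v x y);
  lci_from : forall s t, V (s, t) -> U (f s t, g s t);
  lci_left : forall x y, U (x, y) ->
    f (u x y) (v x y) = x /\ g (u x y) (v x y) = y;
  lci_right : forall s t, V (s, t) ->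
    u (f s t) (g s t) = s /\ v (f s t) (g s t) = t;
  lci_C1f : C1_on2 V f;
  lci_C1g : C1_on2 V g
}.

(* On [U], the metric E dx^2 + 2 F dx dy + G dy^2 equals
   E' du^2 + 2 F' du dv + G' dv^2; the primed coefficients are functions of the
   new parameters (u, v), the partial derivatives are taken in the old ones. *)
Definition components_in (U : R * R -> Prop) (E F G : R -> R -> R)
    (u v : R -> R -> R) (E' F' G' : R -> R -> R) : Prop :=
  forall x y, U (x, y) ->
    let e := E' (u x y) (v x y) in
    let m := F' (u x y) (v x y) in
    let n := G' (u x y) (v x y) in
    E x y = e * (pd1 u x y) ^ 2 + 2 * m * (pd1 u x y * pd1 v x y)
            + n * (pd1 v x y) ^ 2 /\
    F x y = e * (pd1 u x y * pd2 u x y)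
            + m * (pd1 u x y * pd2 v x y + pd2 u x y * pd1 v x y)
            + n * (pd1 v x y * pd2 v x y) /\
    G x y = e * (pd2 u x y) ^ 2 + 2 * m * (pd2 u x y * pd2 v x y)
            + n * (pd2 v x y) ^ 2.

(* [f], [g] recover the old parameters from the new ones (s, t).  Inversion is
   total: these formulas are meaningful only where the inverted partial
   derivatives are nonzero. *)
Definition coefR (G u f g : R -> R -> R) (s t : R) : R :=
  / (pd2 u (f s t) (g s t)) ^ 2 *
  (G (f s t) (g s t) / (G (f s t) (g s t) + 1)).

Definition coefS (G v f g : R -> R -> R) (s t : R) : R :=
  / (pd2 v (f s t) (g s t)) ^ 2 *
  ((G (f s t) (g s t)) ^ 2 / (G (f s t) (g s t) + 1)).

(* Main.v *)
Require Import Defs.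
From Stdlib Require Import Reals Lra Ranalysis5 ClassicalEpsilon.
From Coquelicot Require Import Coquelicot.
Open Scope R_scope.

(* Since [v_y = - G v_x] with [G > 0], the Jacobian determinant
   [h' (v_y - v_x) = - h' (1 + G) v_x] vanishes only where [v_x] does, so the
   inverse function theorem applies near [y = 0].  For this particular map it
   reduces to one variable: on each level [x + y = w] of [u], the function
   [x |-> v (x, w - x)] has derivative [(1 + G) v_x <> 0].  Conversely, a local
   C^1 inverse forces [v_x <> 0] by the chain rule, and the formulas for R and S
   then follow by substituting the two differential equations. *)

(** * Partial derivatives and total differentials in the plane *)

Lemma open_locally_2d (U : R * R -> Prop) (x y : R) :
  open U -> U (x, y) -> locally_2d (fun x' y' => U (x', y')) x y.
Proof.
  intros HU Hxy. apply locally_2d_locally.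
  eapply filter_imp; [|exact (HU _ Hxy)]. now intros [p q].
Qed.

(** The first partial exists on a neighborhood, because [D] is open, and is continuous at the point;
    together with the second partial at the point this yields the total differential. *)
Lemma C1_on2_differentiable (D : R * R -> Prop) (F : R -> R -> R) (x y : R) :
  open D -> C1_on2 D F -> D (x, y) ->
  differentiable_pt_lim F x y (pd1 F x y) (pd2 F x y).
Proof.
  intros HD HF Hxy.
  apply filterdiff_differentiable_pt_lim.
  apply (is_derive_filterdiff F x y (pd1 F) (pd2 F x y)).
  - eapply filter_imp; [|exact (HD _ Hxy)]. intros [p q] Hpq. simpl.
    apply Derive_correct. now destruct (HF p q Hpq) as [_ [H _]].
  - apply Derive_correct. now destruct (HF x y Hxy) as [_ [_ [H _]]].
  - destruct (HF x y Hxy) as [_ [_ [_ [H _]]]].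
    now apply continuity_2d_pt_filterlim, H.
Qed.

(** Since [D] is open, uniqueness of the differential identifies [F1] and [F2] with the actual
    partial derivatives on a whole neighborhood, so their continuity carries over. This is how C^1
    regularity of [u] and of the inverse is obtained from explicit formulas. *)
Lemma C1_on2_intro (D : R * R -> Prop) (F F1 F2 : R -> R -> R) :
  open D ->
  (forall x y, D (x, y) -> differentiable_pt_lim F x y (F1 x y) (F2 x y)) ->
  (forall x y, D (x, y) -> continuity_2d_pt F1 x y) ->
  (forall x y, D (x, y) -> continuity_2d_pt F2 x y) ->
  C1_on2 D F.
Proof.
  intros HD HF H1 H2 x y Hxy.
  assert (Hl := open_locally_2d D x y HD Hxy).
  split; [|split; [|split; [|split; split; trivial]]].
  - apply differentiable_continuity_pt. eexists; eexists. now apply HF.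
  - eexists. apply is_derive_Reals.
    apply (derivable_pt_lim_comp_2d F (fun z => z) (fun _ => y) x _ _ 1 0
             (HF x y Hxy)).
    apply derivable_pt_lim_id. apply derivable_pt_lim_const.
  - eexists. apply is_derive_Reals.
    apply (derivable_pt_lim_comp_2d F (fun _ => x) (fun z => z) y _ _ 0 1
             (HF x y Hxy)).
    apply derivable_pt_lim_const. apply derivable_pt_lim_id.
  - apply (continuity_2d_pt_ext_loc F1); [|now apply H1].
    destruct Hl as [d Hd]; exists d; intros p q Hp Hq.
    symmetry. now apply (differentiable_pt_lim_unique _ _ _ _ _ (HF p q (Hd p q Hp Hq))).
  - apply (continuity_2d_pt_ext_loc F2); [|now apply H2].
    destruct Hl as [d Hd]; exists d; intros p q Hp Hq.
    symmetry. now apply (differentiable_pt_lim_unique _ _ _ _ _ (HF p q (Hd p q Hp Hq))).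
Qed.

Lemma continuity_2d_pt_comp_2d (F f g : R -> R -> R) (x y : R) :
  continuity_2d_pt F (f x y) (g x y) ->
  continuity_2d_pt f x y -> continuity_2d_pt g x y ->
  continuity_2d_pt (fun p q => F (f p q) (g p q)) x y.
Proof.
  intros HF Hf Hg eps.
  destruct (HF eps) as [d Hd].
  destruct (Hf d) as [d1 Hd1], (Hg d) as [d2 Hd2].
  exists (mkposreal _ (Rmin_stable_in_posreal d1 d2)). simpl. intros p q Hp Hq.
  apply Hd; [apply Hd1 | apply Hd2];
    (eapply Rlt_le_trans; [eassumption|]); auto using Rmin_l, Rmin_r.
Qed.

(** * Sign changes, intermediate values and injectivity in one variable *)

(** Close to [c] the difference quotients lie within |l| of [l], hence have the sign of [l] on both
    sides. Writing the sign change as a negative product avoids a case split on the sign of [l] in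
    later uses. *)
Lemma is_derive_opposite_increments (f : R -> R) (c l eps : R) :
  is_derive f c l -> l <> 0 -> 0 < eps ->
  exists d, 0 < d < eps /\ (f (c - d) - f c) * (f (c + d) - f c) < 0.
Proof.
  intros Hf Hl He.
  apply is_derive_Reals in Hf.
  destruct (Hf (Rabs l) (Rabs_pos_lt _ Hl)) as [[d Hd0] Hd]. simpl in Hd.
  set (e := Rmin eps d / 2).
  assert (H0 : 0 < Rmin eps d) by now apply Rmin_glb_lt.
  assert (H1 := Rmin_l eps d). assert (H2 := Rmin_r eps d).
  exists e. split; [unfold e; lra|].
  assert (Ep : Rabs e < d) by (rewrite Rabs_pos_eq; unfold e; lra).
  assert (Em : Rabs (- e) < d) by now rewrite Rabs_Ropp.
  assert (Hep : 0 < e) by (unfold e; lra).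
  assert (Pp := Hd e ltac:(lra) Ep).
  assert (Pm := Hd (- e) ltac:(lra) Em).
  replace (c + - e) with (c - e) in Pm by ring.
  set (A := f (c + e) - f c) in *. set (B := f (c - e) - f c) in *.
  assert (EA : A = A / e * e) by (field; lra).
  assert (EB : B = - (B / - e * e)) by (field; lra).
  set (a := A / e) in *. set (b := B / - e) in *.
  rewrite EA, EB.
  (* [a] and [b] are the right and left difference quotients; both have the sign of [l]. *)
  assert (0 < a * b).
  { clearbody a b. revert Pp Pm. unfold Rabs at 1 3.
    destruct (Rcase_abs (a - l)), (Rcase_abs (b - l)); unfold Rabs;
      destruct (Rcase_abs l); intros; nra. }
  assert (0 < e * e) by nra.
  replace (- (b * e) * (a * e)) with (- ((a * b) * (e * e))) by ring.
  assert (0 < (a * b) * (e * e)) by now apply Rmult_lt_0_compat.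
  lra.
Qed.

Lemma IVT_opposite_signs (f : R -> R) (x y c : R) :
  (forall z, x <= z <= y -> continuity_pt f z) -> x < y ->
  (f x - c) * (f y - c) < 0 -> exists z, x <= z <= y /\ f z = c.
Proof.
  intros Hf Hxy Hs.
  assert (Hc : forall z, continuity_pt (fun _ => c) z)
    by (intros z; apply continuity_pt_const; intros p q; reflexivity).
  assert (Hn : f x - c <> 0) by (intros E; rewrite E in Hs; lra).
  destruct (Rlt_le_dec (f x - c) 0) as [Hx|Hx].
  - destruct (IVT_interv (fun z => f z - c) x y) as [z [Hz E]]; trivial.
    + intros z Hz. apply continuity_pt_minus; auto.
    + nra.
    + exists z. split; trivial. lra.
  - destruct (IVT_interv (fun z => c - f z) x y) as [z [Hz E]]; trivial.
    + intros z Hz. apply continuity_pt_minus; auto.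
    + nra.
    + nra.
    + exists z. split; trivial. lra.
Qed.

(** Mean value theorem on the segment between the two points, taken in either order. *)
Lemma derive_nonzero_injective (f df : R -> R) (x y : R) :
  (forall z, Rmin x y <= z <= Rmax x y -> is_derive f z (df z) /\ df z <> 0) ->
  f x = f y -> x = y.
Proof.
  intros H E.
  destruct (MVT_gen f x y df) as [c [Hc Ec]].
  - intros z Hz. apply H. lra.
  - intros z Hz. apply derivable_continuous_pt. exists (df z).
    apply is_derive_Reals. now apply H.
  - destruct (H c Hc) as [_ Hn].
    assert (df c * (y - x) = 0) by lra.
    destruct (Rmult_integral _ _ H0); [contradiction|lra].
Qed.

(** * Differentiability of a continuous inverse *)

(** Let m and M be the max norms of (X, Y) and (s, t). Applying the inverse matrix to the residual
    leaves an error of at most C e m. As C e <= 1/2, this error can be absorbed to give m <= 2 C M,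
    so the bound becomes relative to M. *)
Lemma linear_system_perturbation (a b c d : R) :
  a * d - b * c <> 0 ->
  exists C, 0 < C /\ forall X Y s t e,
    Rabs (s - (a * X + b * Y)) <= e * Rmax (Rabs X) (Rabs Y) ->
    Rabs (t - (c * X + d * Y)) <= e * Rmax (Rabs X) (Rabs Y) ->
    0 < e -> C * e <= 1 / 2 ->
    Rabs (X - (d / (a * d - b * c) * s + - b / (a * d - b * c) * t))
      <= 2 * C * C * e * Rmax (Rabs s) (Rabs t) /\
    Rabs (Y - (- c / (a * d - b * c) * s + a / (a * d - b * c) * t))
      <= 2 * C * C * e * Rmax (Rabs s) (Rabs t).
Proof.
  intros Hdet. set (k := a * d - b * c) in *.
  (* [C] dominates both absolute row sums of the inverse matrix; the added 1 makes it positive. *)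
  set (C := Rabs (a / k) + Rabs (b / k) + Rabs (c / k) + Rabs (d / k) + 1).
  assert (Pa := Rabs_pos (a / k)). assert (Pb := Rabs_pos (b / k)).
  assert (Pc := Rabs_pos (c / k)). assert (Pd := Rabs_pos (d / k)).
  exists C. split; [unfold C; lra|].
  intros X Y s t e Hs Ht He HC.
  set (m := Rmax (Rabs X) (Rabs Y)) in *. set (M := Rmax (Rabs s) (Rabs t)).
  assert (HC0 : 0 < C) by (unfold C; lra).
  assert (comb : forall p q A B n, Rabs p + Rabs q <= C -> Rabs A <= n ->
            Rabs B <= n -> Rabs (p * A + q * B) <= C * n).
  { intros p q A B n Hpq HA HB.
    eapply Rle_trans; [apply Rabs_triang|]. rewrite !Rabs_mult.
    assert (0 <= n) by (eapply Rle_trans; [apply Rabs_pos|eassumption]).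
    assert (Hp := Rabs_pos p). assert (Hq := Rabs_pos q).
    assert (Rabs p * Rabs A <= Rabs p * n) by now apply Rmult_le_compat_l.
    assert (Rabs q * Rabs B <= Rabs q * n) by now apply Rmult_le_compat_l.
    nra. }
  assert (Nb : Rabs (- b / k) = Rabs (b / k))
    by (rewrite <- Rabs_Ropp; f_equal; now field).
  assert (Nc : Rabs (- c / k) = Rabs (c / k))
    by (rewrite <- Rabs_Ropp; f_equal; now field).
  assert (HX : Rabs (X - (d / k * s + - b / k * t)) <= C * (e * m)).
  { replace (X - (d / k * s + - b / k * t)) with
      (- (d / k * (s - (a * X + b * Y)) + - b / k * (t - (c * X + d * Y))))
      by (unfold k; field; exact Hdet).
    rewrite Rabs_Ropp. apply comb; trivial. rewrite Nb. unfold C; lra. }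
  assert (HY : Rabs (Y - (- c / k * s + a / k * t)) <= C * (e * m)).
  { replace (Y - (- c / k * s + a / k * t)) with
      (- (- c / k * (s - (a * X + b * Y)) + a / k * (t - (c * X + d * Y))))
      by (unfold k; field; exact Hdet).
    rewrite Rabs_Ropp. apply comb; trivial. rewrite Nc. unfold C; lra. }
  assert (LX : Rabs (d / k * s + - b / k * t) <= C * M).
  { apply comb; [rewrite Nb; unfold C; lra|apply Rmax_l|apply Rmax_r]. }
  assert (LY : Rabs (- c / k * s + a / k * t) <= C * M).
  { apply comb; [rewrite Nc; unfold C; lra|apply Rmax_l|apply Rmax_r]. }
  assert (Hm : m <= C * M + C * (e * m)).
  { unfold m at 1. apply Rmax_lub.
    - replace X with ((d / k * s + - b / k * t) + (X - (d / k * s + - b / k * t)))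
        at 1 by ring.
      eapply Rle_trans; [apply Rabs_triang|lra].
    - replace Y with ((- c / k * s + a / k * t) + (Y - (- c / k * s + a / k * t)))
        at 1 by ring.
      eapply Rle_trans; [apply Rabs_triang|lra]. }
  assert (m0 : 0 <= m) by (eapply Rle_trans; [apply (Rabs_pos X)|apply Rmax_l]).
  assert (Hm2 : m <= 2 * (C * M)) by nra.
  assert (Hm3 : C * (e * m) <= 2 * C * C * e * M).
  { replace (2 * C * C * e * M) with (C * (e * (2 * (C * M)))) by ring.
    apply Rmult_le_compat_l; [lra|]. apply Rmult_le_compat_l; lra. }
  split; lra.
Qed.

(** Continuity of [f] and [g] keeps their increments where the first-order expansions of [u] and [v]
    are valid. Those expansions form a perturbed linear system for the increments, which the
    previous lemma inverts; the new coefficients are the entries of the inverse Jacobian matrix. *)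
Lemma inverse_differentiable (u v f g : R -> R -> R) (s t a b c d : R) :
  differentiable_pt_lim u (f s t) (g s t) a b ->
  differentiable_pt_lim v (f s t) (g s t) c d ->
  a * d - b * c <> 0 ->
  continuity_2d_pt f s t -> continuity_2d_pt g s t ->
  locally_2d (fun p q => u (f p q) (g p q) = p /\ v (f p q) (g p q) = q) s t ->
  differentiable_pt_lim f s t (d / (a * d - b * c)) (- b / (a * d - b * c)) /\
  differentiable_pt_lim g s t (- c / (a * d - b * c)) (a / (a * d - b * c)).
Proof.
  intros Hu Hv Hdet Hf Hg Hinv.
  destruct (linear_system_perturbation a b c d Hdet) as [C [HC0 HC]].
  set (k := a * d - b * c) in *.
  assert (H : forall eps : posreal, locally_2d (fun p q =>
    Rabs (f p q - f s t - (d / k * (p - s) + - b / k * (q - t)))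
      <= eps * Rmax (Rabs (p - s)) (Rabs (q - t)) /\
    Rabs (g p q - g s t - (- c / k * (p - s) + a / k * (q - t)))
      <= eps * Rmax (Rabs (p - s)) (Rabs (q - t))) s t).
  { intros [eps Heps]. simpl.
    assert (HCC : 0 < C * C) by nra.
    (* The first bound permits absorption (C e <= 1/2), the second makes the resulting error 2 C C e
       at most [eps]. *)
    set (e := Rmin (/ (2 * C)) (eps / (2 * (C * C)))).
    assert (He : 0 < e).
    { apply Rmin_glb_lt. apply Rinv_0_lt_compat; lra.
      apply Rdiv_lt_0_compat; lra. }
    assert (E1 : C * e <= 1 / 2).
    { apply Rle_trans with (C * / (2 * C)).
      apply Rmult_le_compat_l; [lra|apply Rmin_l]. right; field; lra. }
    assert (E2 : 2 * C * C * e <= eps).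
    { apply Rle_trans with (2 * C * C * (eps / (2 * (C * C)))).
      apply Rmult_le_compat_l; [nra|apply Rmin_r]. right; field; lra. }
    destruct (Hu (mkposreal e He)) as [d1 Hd1].
    destruct (Hv (mkposreal e He)) as [d2 Hd2]. simpl in Hd1, Hd2.
    assert (F1 := Hf (mkposreal _ (Rmin_stable_in_posreal d1 d2))).
    assert (G1 := Hg (mkposreal _ (Rmin_stable_in_posreal d1 d2))).
    assert (Hst := locally_2d_singleton _ _ _ Hinv). simpl in Hst.
    destruct Hst as [Es Et].
    refine (locally_2d_impl _ _ _ _ _
      (locally_2d_and _ _ _ _ Hinv (locally_2d_and _ _ _ _ F1 G1))).
    apply locally_2d_forall. intros p q [[Ep Eq] [Fp Gp]]. simpl in Fp, Gp.
    assert (M1 := Rmin_l d1 d2). assert (M2 := Rmin_r d1 d2).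
    specialize (Hd1 (f p q) (g p q) ltac:(lra) ltac:(lra)).
    specialize (Hd2 (f p q) (g p q) ltac:(lra) ltac:(lra)).
    rewrite Ep, Es in Hd1. rewrite Eq, Et in Hd2.
    destruct (HC _ _ _ _ _ Hd1 Hd2 He E1) as [HX HY].
    assert (0 <= Rmax (Rabs (p - s)) (Rabs (q - t)))
      by (eapply Rle_trans; [apply (Rabs_pos (p - s))|apply Rmax_l]).
    assert (2 * C * C * e * Rmax (Rabs (p - s)) (Rabs (q - t)) <=
      eps * Rmax (Rabs (p - s)) (Rabs (q - t)))
      by now apply Rmult_le_compat_r.
    split; lra. }
  split; intros eps; refine (locally_2d_impl _ _ _ _ _ (H eps));
    apply locally_2d_forall; tauto.
Qed.

(** * From injectivity and openness to a C^1 inverse *)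

(** The last hypothesis is openness in quantitative form: nearby values have preimages within [eps].
    It makes the image open and, combined with injectivity, the inverse continuous;
    differentiability then follows from the nonzero Jacobian. *)
Lemma open_injective_local_C1_inverse (D U : R * R -> Prop) (p : R * R)
    (u v : R -> R -> R) :
  open U -> U p -> (forall q, U q -> D q) -> C1_on2 U u -> C1_on2 U v ->
  (forall x y, U (x, y) -> pd1 u x y * pd2 v x y - pd2 u x y * pd1 v x y <> 0) ->
  (forall x y x' y', U (x, y) -> U (x', y') ->
     u x y = u x' y' -> v x y = v x' y' -> x = x' /\ y = y') ->
  (forall x y (eps : posreal), U (x, y) ->
     locally_2d (fun s t => exists x' y', U (x', y') /\
       Rabs (x' - x) < eps /\ Rabs (y' - y) < eps /\ u x' y' = s /\ v x' y' = t)
       (u x y) (v x y)) ->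
  exists (V : R * R -> Prop) (f g : R -> R -> R),
    local_C1_inverse D p u v U V f g.
Proof.
  intros HU Hp HD Hu Hv Hdet Hinj Hopen.
  set (V := fun q : R * R => exists x y, U (x, y) /\ u x y = fst q /\ v x y = snd q).
  (* The inverse is chosen pointwise on the image [V]; outside [V] its value is arbitrary. *)
  set (F := fun s t => epsilon (inhabits p)
              (fun q => U q /\ u (fst q) (snd q) = s /\ v (fst q) (snd q) = t)).
  set (f := fun s t => fst (F s t)). set (g := fun s t => snd (F s t)).
  assert (HF : forall s t, V (s, t) ->
    U (f s t, g s t) /\ u (f s t) (g s t) = s /\ v (f s t) (g s t) = t).
  { intros s t (x & y & Hxy & Es & Et). unfold f, g.
    rewrite <- surjective_pairing. apply epsilon_spec. now exists (x, y). }
  assert (HVl : forall s t, V (s, t) -> locally_2d (fun s' t' => V (s', t')) s t).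
  { intros s t (x & y & Hxy & Es & Et). simpl in Es, Et. subst s t.
    refine (locally_2d_impl _ _ _ _ _ (Hopen x y (mkposreal 1 Rlt_0_1) Hxy)).
    apply locally_2d_forall. intros s t (x' & y' & H & _ & _ & E). now exists x', y'. }
  assert (HVo : open V).
  { intros [s t] Hst. assert (H := HVl s t Hst). apply locally_2d_locally in H.
    eapply filter_imp; [|exact H]. now intros [s' t']. }
  assert (Hcont : forall s t, V (s, t) -> continuity_2d_pt f s t /\ continuity_2d_pt g s t).
  { intros s t Hst. destruct (HF s t Hst) as (H & Es & Et).
    assert (Hl : forall eps : posreal, locally_2d (fun s' t' =>
      Rabs (f s' t' - f s t) < eps /\ Rabs (g s' t' - g s t) < eps) s t).
    { intros eps. assert (Ho := Hopen _ _ eps H). rewrite Es, Et in Ho.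
      refine (locally_2d_impl _ _ _ _ _ (locally_2d_and _ _ _ _ (HVl s t Hst) Ho)).
      apply locally_2d_forall.
      intros s' t' [H' (x' & y' & Hxy' & Hx' & Hy' & Es' & Et')].
      destruct (HF s' t' H') as (Hfg' & Ef & Eg).
      (* The nearby preimage given by openness is, by injectivity, the chosen one. *)
      destruct (Hinj _ _ _ _ Hfg' Hxy') as [-> ->]; [congruence|congruence|].
      now split. }
    split; intros eps; refine (locally_2d_impl _ _ _ _ _ (Hl eps));
      apply locally_2d_forall; tauto. }
  set (k := fun x y => pd1 u x y * pd2 v x y - pd2 u x y * pd1 v x y).
  assert (Hdiff : forall s t, V (s, t) ->
    differentiable_pt_lim f s t (pd2 v (f s t) (g s t) / k (f s t) (g s t))
      (- pd2 u (f s t) (g s t) / k (f s t) (g s t)) /\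
    differentiable_pt_lim g s t (- pd1 v (f s t) (g s t) / k (f s t) (g s t))
      (pd1 u (f s t) (g s t) / k (f s t) (g s t))).
  { intros s t Hst. destruct (HF s t Hst) as (H & Es & Et).
    destruct (Hcont s t Hst) as [Hf Hg].
    apply (inverse_differentiable u v f g s t); auto.
    - now apply (C1_on2_differentiable U).
    - now apply (C1_on2_differentiable U).
    - refine (locally_2d_impl _ _ _ _ _ (HVl s t Hst)).
      apply locally_2d_forall. intros s' t' H'. now apply HF. }
  assert (Hcomp : forall n, (forall x y, U (x, y) -> continuity_2d_pt n x y) ->
    forall s t, V (s, t) ->
    continuity_2d_pt (fun s t => n (f s t) (g s t) / k (f s t) (g s t)) s t).
  { intros n Hn s t Hst. destruct (HF s t Hst) as (H & _).
    destruct (Hcont s t Hst) as [Hf Hg].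
    apply (continuity_2d_pt_comp_2d (fun x y => n x y / k x y)); trivial.
    destruct (Hu _ _ H) as (_ & _ & _ & [Hu1 _] & [Hu2 _]).
    destruct (Hv _ _ H) as (_ & _ & _ & [Hv1 _] & [Hv2 _]).
    apply continuity_2d_pt_mult; [now apply Hn|].
    apply continuity_2d_pt_inv; [|now apply Hdet].
    apply continuity_2d_pt_minus; now apply continuity_2d_pt_mult. }
  assert (Cu1 : forall x y, U (x, y) -> continuity_2d_pt (pd1 u) x y)
    by (intros x y H; apply (Hu x y H)).
  assert (Cv1 : forall x y, U (x, y) -> continuity_2d_pt (pd1 v) x y)
    by (intros x y H; apply (Hv x y H)).
  assert (Cu2 : forall x y, U (x, y) -> continuity_2d_pt (pd2 u) x y)
    by (intros x y H; apply (Hu x y H)).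
  assert (Cv2 : forall x y, U (x, y) -> continuity_2d_pt (pd2 v) x y)
    by (intros x y H; apply (Hv x y H)).
  exists V, f, g. split; trivial.
  - intros x y H. now exists x, y.
  - intros s t H. now apply HF.
  - intros x y H.
    destruct (HF (u x y) (v x y)) as (H' & Es & Et); [now exists x, y|].
    now apply Hinj.
  - intros s t H. now apply HF.
  - apply (C1_on2_intro V f _ _ HVo (fun s t H => proj1 (Hdiff s t H))).
    + now apply Hcomp.
    + apply (Hcomp (fun x y => - pd2 u x y)).
      intros x y H. now apply continuity_2d_pt_opp, Cu2.
  - apply (C1_on2_intro V g _ _ HVo (fun s t H => proj2 (Hdiff s t H))).
    + apply (Hcomp (fun x y => - pd1 v x y)).
      intros x y H. now apply continuity_2d_pt_opp, Cv1.
    + now apply Hcomp.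
Qed.

(** * Openness of the map with components h(x + y) and v(x, y) *)

Lemma is_derive_along_antidiagonal (F : R -> R -> R) (w x l1 l2 : R) :
  differentiable_pt_lim F x (w - x) l1 l2 ->
  is_derive (fun z => F z (w - z)) x (l1 - l2).
Proof.
  intros HF. apply is_derive_Reals.
  replace (l1 - l2) with (l1 * 1 + l2 * (0 - 1)) by ring.
  apply (derivable_pt_lim_comp_2d F (fun z => z) (fun z => w - z)); trivial.
  - apply derivable_pt_lim_id.
  - apply (derivable_pt_lim_minus (fun _ => w) (fun z => z)).
    apply derivable_pt_lim_const. apply derivable_pt_lim_id.
Qed.

Lemma is_derive_continuity_pt (f : R -> R) (x l : R) :
  is_derive f x l -> continuity_pt f x.
Proof.
  intros H. apply derivable_continuous_pt. exists l. now apply is_derive_Reals.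
Qed.

(** A strict sign change survives small changes of both the parameter and the target value, so the
    intermediate value theorem applies uniformly to nearby levels and targets. *)
Lemma continuity_pt_product_neg (f1 f2 : R -> R) (x c : R) :
  continuity_pt f1 x -> continuity_pt f2 x -> (f1 x - c) * (f2 x - c) < 0 ->
  locally_2d (fun z d => (f1 z - d) * (f2 z - d) < 0) x c.
Proof.
  intros H1 H2 Hn.
  assert (Hc : continuity_2d_pt (fun z d => (f1 z - d) * (f2 z - d)) x c).
  { apply continuity_2d_pt_mult; apply continuity_2d_pt_minus;
      try apply continuity_2d_pt_id2;
      [apply (continuity_1d_2d_pt_comp f1 (fun z _ => z))
      |apply (continuity_1d_2d_pt_comp f2 (fun z _ => z))]; trivial;
      apply continuity_2d_pt_id1. }
  assert (Hp : 0 < - ((f1 x - c) * (f2 x - c))) by lra.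
  refine (locally_2d_impl _ _ _ _ _ (Hc (mkposreal _ Hp))).
  apply locally_2d_forall. simpl. intros z d H. apply Rabs_def2 in H. lra.
Qed.

(* The image point is reached by choosing first the level [x + y = w] of [u],
   then the abscissa [x] on that level, each time by the intermediate value
   theorem. *)
Lemma sum_map_open (U : R * R -> Prop) (h : R -> R) (v : R -> R -> R) (x y : R)
    (eps : posreal) :
  open U -> C1_on2 U v ->
  (forall x y, U (x, y) -> ex_derive h (x + y)) -> U (x, y) ->
  Derive h (x + y) <> 0 -> pd1 v x y <> pd2 v x y ->
  locally_2d (fun s t => exists x' y', U (x', y') /\
    Rabs (x' - x) < eps /\ Rabs (y' - y) < eps /\ h (x' + y') = s /\ v x' y' = t)
    (h (x + y)) (v x y).
Proof.
  intros HU Hv Hh Hxy Hh' Hv'.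
  destruct (open_locally_2d U x y HU Hxy) as [[r0 Hr0] Hr]. simpl in Hr.
  destruct eps as [eps Heps]. simpl.
  (* Halved because the ordinate [w - x'] can deviate from [y] by the sum of the deviations of [w]
     and of [x']. *)
  set (r := Rmin r0 eps / 2).
  assert (Hrm : 0 < Rmin r0 eps) by now apply Rmin_glb_lt.
  assert (R1 := Rmin_l r0 eps). assert (R2 := Rmin_r r0 eps).
  assert (Hbox : forall x' w, Rabs (x' - x) < r -> Rabs (w - (x + y)) < r ->
    U (x', w - x') /\ Rabs (x' - x) < eps /\ Rabs (w - x' - y) < eps).
  { unfold r. intros x' w Hx Hw. apply Rabs_def2 in Hx. apply Rabs_def2 in Hw.
    split; [apply Hr|split]; apply Rabs_def1; lra. }
  assert (Hr1 : 0 < r) by (unfold r; lra). clearbody r. clear Hr.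
  assert (Hphi : forall x' w, Rabs (x' - x) < r -> Rabs (w - (x + y)) < r ->
    is_derive (fun z => v z (w - z)) x' (pd1 v x' (w - x') - pd2 v x' (w - x'))).
  { intros x' w Hx Hw. apply is_derive_along_antidiagonal.
    apply (C1_on2_differentiable U); trivial. now apply Hbox. }
  assert (Ey : x + y - x = y) by ring.
  (* On the level through (x, y), [v] passes through its value at that point between the abscissas
     [x - d] and [x + d]; below, [q] bounds how far level and target may move while this
     persists. *)
  destruct (is_derive_opposite_increments (fun z => v z (x + y - z)) x
    (pd1 v x y - pd2 v x y) r) as [d [Hd Sd]]; trivial.
  { assert (H := Hphi x (x + y)). rewrite Ey in H.
    apply H; rewrite Rminus_diag, Rabs_R0; trivial. }
  { lra. }
  rewrite Ey in Sd.
  assert (Hc : forall x', Rabs (x' - x) < r ->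
    continuity_pt (fun w => v x' (w - x')) (x + y)).
  { intros x' Hx. assert (H : U (x', x + y - x')).
    { apply Hbox; trivial. now rewrite Rminus_diag, Rabs_R0. }
    apply (is_derive_continuity_pt _ _ (pd2 v x' (x + y - x') * (1 - 0))).
    apply is_derive_Reals.
    apply (derivable_pt_lim_comp (fun w => w - x') (fun z => v x' z)).
    - apply (derivable_pt_lim_minus (fun w => w) (fun _ => x')).
      apply derivable_pt_lim_id. apply derivable_pt_lim_const.
    - apply is_derive_Reals, Derive_correct. apply (Hv _ _ H). }
  destruct (continuity_pt_product_neg (fun w => v (x - d) (w - (x - d)))
    (fun w => v (x + d) (w - (x + d))) (x + y) (v x y)) as [[q Hq0] Hq]; trivial.
  { apply Hc. apply Rabs_def1; lra. }
  { apply Hc. apply Rabs_def1; lra. }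
  simpl in Hq.
  destruct (is_derive_opposite_increments h (x + y) (Derive h (x + y)) (Rmin q r))
    as [e [He Se]]; trivial.
  { now apply Derive_correct, Hh. }
  { now apply Rmin_glb_lt. }
  assert (Q1 := Rmin_l q r). assert (Q2 := Rmin_r q r).
  (* Only the target varies here: the two functions are constant and the parameter 0 is a dummy. *)
  destruct (continuity_pt_product_neg (fun _ => h (x + y - e))
    (fun _ => h (x + y + e)) 0 (h (x + y))) as [[q' Hq'0] Hq']; trivial;
    try (apply continuity_pt_const; intros ? ?; reflexivity).
  simpl in Hq'.
  exists (mkposreal _ (Rmin_glb_lt _ _ _ Hq0 Hq'0)). simpl.
  assert (M1 := Rmin_l q q'). assert (M2 := Rmin_r q q').
  intros s t Hs Ht.
  destruct (IVT_opposite_signs h (x + y - e) (x + y + e) s) as [w [Hw Ew]].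
  - intros w Hw. apply (is_derive_continuity_pt _ _ (Derive h w)).
    apply Derive_correct. replace w with (x + (w - x)) by ring. apply Hh.
    apply Hbox; apply Rabs_def1; lra.
  - lra.
  - apply (Hq' 0); [rewrite Rminus_diag, Rabs_R0; trivial|lra].
  - assert (Hw' : Rabs (w - (x + y)) < r) by (apply Rabs_def1; lra).
    destruct (IVT_opposite_signs (fun z => v z (w - z)) (x - d) (x + d) t)
      as [z [Hz Ez]].
    + intros z Hz. eapply is_derive_continuity_pt. apply Hphi; trivial.
      apply Rabs_def1; lra.
    + lra.
    + apply Hq; [apply Rabs_def1; lra|lra].
    + exists z, (w - z).
      destruct (Hbox z w) as (H1 & H2 & H3); trivial. apply Rabs_def1; lra.
      repeat split; trivial. now rewrite <- Ew; f_equal; ring.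
Qed.

(** * Regularity of u and the chain rule for a left inverse *)

Lemma C1_on2_subset (D U : R * R -> Prop) (F : R -> R -> R) :
  (forall q, U q -> D q) -> C1_on2 D F -> C1_on2 U F.
Proof. intros HU HF x y H. now apply HF, HU. Qed.

Lemma differentiable_pt_lim_comp_sum (h : R -> R) (x y l : R) :
  is_derive h (x + y) l -> differentiable_pt_lim (fun x y => h (x + y)) x y l l.
Proof.
  intros Hh.
  assert (Hs : differentiable_pt_lim Rplus x y 1 1).
  { intros eps. apply locally_2d_forall. intros p q.
    replace (p + q - (x + y) - (1 * (p - x) + 1 * (q - y))) with 0 by ring.
    rewrite Rabs_R0. apply Rmult_le_pos; [apply Rlt_le, cond_pos|].
    eapply Rle_trans; [apply (Rabs_pos (p - x))|apply Rmax_l]. }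
  (* [h] is viewed as a function of two variables that ignores the second, so [Rplus] fills both
     inner slots. *)
  assert (H := differentiable_pt_lim_comp (fun p _ => h p) Rplus Rplus x y l 0 1 1 1 1
    (differentiable_pt_lim_proj1_0 h (x + y) (x + y) l
       (proj1 (is_derive_Reals _ _ _) Hh)) Hs Hs).
  now replace (l * 1 + 0 * 1) with l in H by ring.
Qed.

Lemma C1_on2_comp_sum (D : R * R -> Prop) (J : R -> Prop) (h : R -> R) :
  open D -> (forall x y, D (x, y) -> J (x + y)) -> C1_on J h ->
  C1_on2 D (fun x y => h (x + y)).
Proof.
  intros HD HJ Hh.
  assert (Hc : forall x y, D (x, y) ->
    continuity_2d_pt (fun x y => Derive h (x + y)) x y).
  { intros x y H. destruct (Hh _ (HJ _ _ H)) as [_ Hc].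
    apply (continuity_1d_2d_pt_comp (Derive h) Rplus).
    - now apply continuity_pt_filterlim.
    - apply continuity_2d_pt_plus; [apply continuity_2d_pt_id1|apply continuity_2d_pt_id2]. }
  apply (C1_on2_intro D _ (fun x y => Derive h (x + y)) (fun x y => Derive h (x + y)));
    trivial.
  intros x y H. apply differentiable_pt_lim_comp_sum, Derive_correct.
  now apply (Hh _ (HJ _ _ H)).
Qed.

(** Differentiate f(u(x, y), v(x, y)) = x on the open set [U]; [l1] and [l2] are the partials of [f]
    at the image point. *)
Lemma left_inverse_chain_rule (D U V : R * R -> Prop) (p : R * R)
    (u v f g : R -> R -> R) (x y : R) :
  local_C1_inverse D p u v U V f g -> C1_on2 U u -> C1_on2 U v -> U (x, y) ->
  exists l1 l2, l1 * pd1 u x y + l2 * pd1 v x y = 1 /\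
    l1 * pd2 u x y + l2 * pd2 v x y = 0.
Proof.
  intros H Hu Hv Hxy. destruct H as [HUo HVo _ _ Hto _ Hl _ Hf _].
  assert (Huv := differentiable_pt_lim_comp f u v x y _ _ _ _ _ _
    (C1_on2_differentiable V f _ _ HVo Hf (Hto x y Hxy))
    (C1_on2_differentiable U u x y HUo Hu Hxy)
    (C1_on2_differentiable U v x y HUo Hv Hxy)).
  assert (Hid : differentiable_pt_lim (fun p _ : R => p) x y 1 0).
  { apply (differentiable_pt_lim_proj1_0 (fun p => p)). apply derivable_pt_lim_id. }
  assert (Huv' := differentiable_pt_lim_ext _ (fun p _ => p) _ _ _ _
    (locally_2d_impl _ _ _ _ (locally_2d_forall _ _ _
       (fun p q H => proj1 (Hl p q H))) (open_locally_2d U x y HUo Hxy)) Huv).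
  destruct (differentiable_pt_lim_unique _ _ _ _ _ Huv') as [E1 E2].
  destruct (differentiable_pt_lim_unique _ _ _ _ _ Hid) as [E3 E4].
  eexists; eexists; split; [rewrite <- E1; exact E3|rewrite <- E2; exact E4].
Qed.

(** * Local invertibility and the components of the metric *)

Theorem theorem3 (D : R * R -> Prop) (J : R -> Prop)
  (G : R -> R -> R) (h : R -> R) (v : R -> R -> R)
  (D_open : open D) (J_open : open J)
  (D_J : forall x y, D (x, y) -> J (x + y))
  (G_C1 : C1_on2 D G)
  (G_pos : forall x y, D (x, y) -> 0 < G x y)
  (h_C1 : C1_on J h)
  (h_reg : forall t, J t -> Derive h t <> 0)
  (v_C1 : C1_on2 D v)
  (v_pde : forall x y, D (x, y) -> G x y * pd1 v x y + pd2 v x y = 0)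
  (v_init : forall x, D (x, 0) -> pd1 v x 0 <> 0) :
  let u := fun x y => h (x + y) in
  forall a, D (a, 0) ->
    (exists (U V : R * R -> Prop) (f g : R -> R -> R),
        local_C1_inverse D (a, 0) u v U V f g) /\
    (forall (U V : R * R -> Prop) (f g : R -> R -> R),
        local_C1_inverse D (a, 0) u v U V f g ->
        (forall s t, V (s, t) ->
           pd2 u (f s t) (g s t) = Derive h (f s t + g s t) /\
           pd2 u (f s t) (g s t) <> 0 /\ pd2 v (f s t) (g s t) <> 0) /\
        components_in U (fun _ _ => 1) (fun _ _ => 0) G u v
          (coefR G u f g) (fun _ _ => 0) (coefS G v f g)).
Proof.
  intros u a Ha.
  assert (Hu : C1_on2 D u) by now apply (C1_on2_comp_sum D J).
  assert (Hup : forall x y, D (x, y) ->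
    pd1 u x y = Derive h (x + y) /\ pd2 u x y = Derive h (x + y)).
  { intros x y H.
    apply (differentiable_pt_lim_unique u x y), differentiable_pt_lim_comp_sum,
      Derive_correct. apply (h_C1 _ (D_J _ _ H)). }
  split.
  - assert (Hloc : locally_2d (fun x y => D (x, y) /\ pd1 v x y <> 0) a 0).
    { apply locally_2d_and; [now apply open_locally_2d|].
      apply continuity_2d_pt_neq_0; [apply (v_C1 _ _ Ha)|now apply v_init]. }
    destruct Hloc as [[r0 Hr0] Hr]. simpl in Hr.
    set (r := r0 / 2). assert (Hr1 : 0 < r) by (unfold r; lra).
    (* A box in the coordinates x and x + y: its slices along levels of [u] and its range of sums
       are intervals, as injectivity requires. With r = r0 / 2 it lies in the square of half-side
       [r0]. *)
    set (U := fun q : R * R => Rabs (fst q - a) < r /\ Rabs (fst q + snd q - a) < r).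
    assert (HU : forall x y, U (x, y) -> D (x, y) /\ pd1 v x y <> 0).
    { intros x y [H1 H2]. simpl in H1, H2. apply Rabs_def2 in H1. apply Rabs_def2 in H2.
      unfold r in *. apply Hr; apply Rabs_def1; lra. }
    assert (HUD : forall q, U q -> D q) by (intros [x y] H; now apply HU).
    assert (HUo : open U).
    { assert (Hball : open (fun z => Rabs z < r)).
      { apply (open_comp Rabs (fun z => z < r)); [|apply open_lt].
        intros z _. apply continuous_Rabs. }
      apply open_and.
      - apply (open_comp (fun q : R * R => fst q - a) (fun z => Rabs z < r)); trivial.
        intros q _. apply @continuous_minus; [apply continuous_fst|apply continuous_const].
      - apply (open_comp (fun q : R * R => fst q + snd q - a) (fun z => Rabs z < r)); trivial.
        intros q _. apply @continuous_minus; [apply @continuous_plus|apply continuous_const].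
        apply continuous_fst. apply continuous_snd. }
    assert (Hv' : forall x y, U (x, y) -> pd1 v x y - pd2 v x y <> 0).
    { intros x y H. destruct (HU x y H) as [HDxy Hn].
      assert (E := v_pde x y HDxy). assert (Gp := G_pos x y HDxy).
      replace (pd1 v x y - pd2 v x y) with ((1 + G x y) * pd1 v x y) by lra.
      apply Rmult_integral_contrapositive_currified; lra. }
    exists U. apply open_injective_local_C1_inverse; trivial.
    + split; simpl; [|rewrite Rplus_0_r]; rewrite Rminus_diag, Rabs_R0; trivial.
    + now apply (C1_on2_subset D).
    + now apply (C1_on2_subset D).
    + intros x y H. destruct (Hup x y (HUD _ H)) as [-> ->].
      replace (Derive h (x + y) * pd2 v x y - Derive h (x + y) * pd1 v x y)
        with (- (Derive h (x + y) * (pd1 v x y - pd2 v x y))) by ring.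
      apply Ropp_neq_0_compat, Rmult_integral_contrapositive_currified;
        [now apply h_reg, D_J, HUD|now apply Hv'].
    + intros x y x' y' H H' E1 E2.
      assert (Ew : x + y = x' + y').
      { apply (derive_nonzero_injective h (Derive h)); trivial.
        intros w Hw.
        assert (HJ : J w).
        (* [J] need not be an interval, so [w] is exhibited as the coordinate sum of the point (a, w
           - a) of [U]. *)
        { replace w with (a + (w - a)) by ring. apply D_J, HUD.
          destruct H as [_ H], H' as [_ H']. simpl in H, H'.
          apply Rabs_def2 in H. apply Rabs_def2 in H'.
          split; simpl.
          rewrite Rminus_diag, Rabs_R0; trivial.
          revert Hw. unfold Rmin, Rmax.
          destruct (Rle_dec (x + y) (x' + y')); intros Hw; apply Rabs_def1; lra. }
        split; [|now apply h_reg]. apply Derive_correct, (h_C1 _ HJ). }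
      (* Both points lie on one level, along which [v] has nonzero derivative. *)
      assert (Ex : x = x').
      { apply (derive_nonzero_injective (fun z => v z (x + y - z))
          (fun z => pd1 v z (x + y - z) - pd2 v z (x + y - z))).
        - intros z Hz.
          assert (Hzu : U (z, x + y - z)).
          { destruct H as [H Hs], H' as [H' _]. simpl in H, H', Hs.
            apply Rabs_def2 in H. apply Rabs_def2 in H'.
            split; simpl.
            - revert Hz. unfold Rmin, Rmax.
              destruct (Rle_dec x x'); intros Hz; apply Rabs_def1; lra.
            - now replace (z + (x + y - z) - a) with (x + y - a) by ring. }
          split; [|now apply Hv'].
          apply is_derive_along_antidiagonal, (C1_on2_differentiable D); auto.
        - simpl. replace (x + y - x) with y by ring.
          now replace (x + y - x') with y' by lra. }
      split; lra.
    + intros x y eps H. apply sum_map_open; trivial.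
      * now apply (C1_on2_subset D).
      * intros x' y' H'. apply (h_C1 _ (D_J _ _ (HUD _ H'))).
      * now apply h_reg, D_J, HUD.
      * assert (H1 := Hv' x y H). lra.
  - intros U V f g Hinv.
    assert (HUD := lci_sub _ _ _ _ _ _ _ _ Hinv).
    (* Here [U] is arbitrary and may leave the initial line. If v_x vanished, so would v_y by the
       equation, and the chain rule would give both l1 h' = 1 and l1 h' = 0. *)
    assert (Hnz : forall x y, U (x, y) -> pd1 v x y <> 0).
    { intros x y H Hv0.
      destruct (left_inverse_chain_rule D U V (a, 0) u v f g x y) as (l1 & l2 & E1 & E2);
        trivial; try now apply (C1_on2_subset D).
      assert (E := v_pde x y (HUD _ H)).
      destruct (Hup x y (HUD _ H)) as [U1 U2].
      rewrite U1, Hv0 in E1. rewrite U2 in E2.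
      rewrite Hv0, Rmult_0_r, Rplus_0_l in E. rewrite E in E2. lra. }
    assert (Hnz2 : forall x y, U (x, y) -> pd2 v x y <> 0).
    { intros x y H. assert (E := v_pde x y (HUD _ H)).
      assert (Gp := G_pos x y (HUD _ H)).
      replace (pd2 v x y) with (- (G x y * pd1 v x y)) by lra.
      apply Ropp_neq_0_compat, Rmult_integral_contrapositive_currified;
        [lra|now apply Hnz]. }
    split.
    + intros s t Hst. assert (H := lci_from _ _ _ _ _ _ _ _ Hinv s t Hst).
      destruct (Hup _ _ (HUD _ H)) as [_ E]. rewrite E.
      split; [trivial|split; [now apply h_reg, D_J, HUD|now apply Hnz2]].
    + intros x y H. simpl. unfold coefR, coefS.
      destruct (lci_left _ _ _ _ _ _ _ _ Hinv x y H) as [-> ->].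
      destruct (Hup x y (HUD _ H)) as [-> ->].
      assert (E : pd2 v x y = - (G x y * pd1 v x y))
        by (assert (E := v_pde x y (HUD _ H)); lra).
      rewrite E.
      assert (Gp := G_pos x y (HUD _ H)).
      assert (N1 := Hnz x y H).
      assert (N2 := h_reg _ (D_J _ _ (HUD _ H))).
      assert (N3 : G x y <> 0) by lra. assert (N4 : G x y + 1 <> 0) by lra.
      (* With R u_x^2 = G/(G+1) and S v_x^2 = 1/(G+1), the three identities reduce to G/(G+1) +
         1/(G+1) = 1, G/(G+1) - G/(G+1) = 0 and G/(G+1) + G^2/(G+1) = G. *)
      repeat split; field; auto.
Qed.
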